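(* For every integer $p\ge 0$: if $p\in\{0,1\}$ then $\mathcal{A}(pK_3\cup C_4)<\mathcal{A}((p+1)K_3\cup K_1)$, and if $p\ge 2$ then $\mathcal{A}(pK_3\cup C_4)>\mathcal{A}((p+1)K_3\cup K_1)$.
   Context: Graphs are finite and simple. For a graph $G$ of order $n$ and an integer $k$, $S(G,k)$ denotes the number of partitions of $V(G)$ into exactly $k$ nonempty stable sets (non-equivalent colorings with exactly $k$ colors). Let $\mathcal{B}(G)=\sum_{k=1}^n S(G,k)$, $\mathcal{T}(G)=\sum_{k=1}^n kS(G,k)$, and $\mathcal{A}(G)=\mathcal{T}(G)/\mathcal{B}(G)$. $G\cup H$ denotes disjoint union, $pH$ the disjoint union of $p$ copies of $H$ ($0H$ is the graph with no vertices), $K_m$ the complete graph and $C_m$ the cycle on $m$ vertices. *)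

(* Defs.v *)
From HB Require Import structures.
From mathcomp Require Import all_boot all_order all_algebra.

Set Implicit Arguments.
Unset Strict Implicit.
Unset Printing Implicit Defensive.

Import Order.TTheory GRing.Theory Num.Theory.

Record sgraph := SGraph {
  vertex :> finType;
  adj : rel vertex;
  adj_sym : symmetric adj;
  adj_irr : irreflexive adj
}.

Definition stable (G : sgraph) (A : {set G}) : bool :=
  [forall x in A, forall y in A, ~~ adj x y].

(* [partition] already excludes the empty block. *)
Definition coloring (G : sgraph) (P : {set {set G}}) : bool :=
  partition P [set: G] && [forall A in P, stable A].

Definition num_colorings (G : sgraph) (k : nat) : nat :=
  #|[set P : {set {set G}} | coloring P & #|P| == k]|.

Definition calB (G : sgraph) : nat :=
  \sum_(1 <= k < #|G|.+1) num_colorings G k.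

Definition calT (G : sgraph) : nat :=
  \sum_(1 <= k < #|G|.+1) k * num_colorings G k.

Definition calA (G : sgraph) : rat := ((calT G)%:R / (calB G)%:R)%R.

Section DisjointUnion.
Variables G H : sgraph.

Definition union_adj (u v : G + H) : bool :=
  match u, v with
  | inl x, inl y => adj x y
  | inr x, inr y => adj x y
  | _, _ => false
  end.

Lemma union_adj_sym : symmetric union_adj.
Proof. by move=> [x|x] [y|y] //=; rewrite adj_sym. Qed.

Lemma union_adj_irr : irreflexive union_adj.
Proof. by move=> [x|x] /=; rewrite adj_irr. Qed.

Definition disjoint_union : sgraph := SGraph union_adj_sym union_adj_irr.

End DisjointUnion.

Section Copies.
Variables (p : nat) (H : sgraph).

Definition copies_adj (u v : 'I_p * H) : bool :=
  (u.1 == v.1) && adj u.2 v.2.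

Lemma copies_adj_sym : symmetric copies_adj.
Proof. by move=> u v; rewrite /copies_adj eq_sym adj_sym. Qed.

Lemma copies_adj_irr : irreflexive copies_adj.
Proof. by move=> u; rewrite /copies_adj adj_irr andbF. Qed.

Definition copies : sgraph := SGraph copies_adj_sym copies_adj_irr.

End Copies.

Section CompleteAndCycle.
Variable m : nat.

Definition complete_adj (i j : 'I_m) : bool := i != j.

Lemma complete_adj_sym : symmetric complete_adj.
Proof. by move=> i j; rewrite /complete_adj eq_sym. Qed.

Lemma complete_adj_irr : irreflexive complete_adj.
Proof. by move=> i; rewrite /complete_adj eqxx. Qed.

Definition complete_graph : sgraph := SGraph complete_adj_sym complete_adj_irr.

(* [ordS] is the cyclic successor; the conjunct [i != j] only matters for
   [m = 1], where it removes a loop. *)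
Definition cycle_adj (i j : 'I_m) : bool :=
  (i != j) && ((j == ordS i) || (i == ordS j)).

Lemma cycle_adj_sym : symmetric cycle_adj.
Proof. by move=> i j; rewrite /cycle_adj eq_sym orbC. Qed.

Lemma cycle_adj_irr : irreflexive cycle_adj.
Proof. by move=> i; rewrite /cycle_adj eqxx. Qed.

Definition cycle_graph : sgraph := SGraph cycle_adj_sym cycle_adj_irr.

End CompleteAndCycle.

(* Main.v *)
(* Writing the chromatic polynomial of G in the falling factorial basis,
     P(G, q) = \sum_(P coloring of G) q ^_ #|P|,
   the coefficients are unique, so calB and calT are the images of P(G, q) under
   the linear functionals q ^_ k |-> 1 and q ^_ k |-> k.  Chromatic polynomials
   are multiplicative over disjoint unions, so for pK_3 u C_4 and
   (p+1)K_3 u K_1 = pK_3 u (K_3 u K_1) all four numbers are sums, over the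
   colorings of pK_3 with k blocks, of explicit polynomials in k.  Symmetrising,
   twice the cross difference T(X) B(Y) - T(Y) B(X) becomes a sum of F(k, l) over
   pairs of colorings, where F(k, l) >= 0 for k, l >= 3 except F(3, 3) = -224.
   For p = 0 and p = 1 only the terms F(0, 0) = -8, resp. F(3, 3), occur; for
   p >= 2 evaluating (q ^_ 3) ^ p at q = 3 and q = 4 shows that there are at least
   as many colorings with 4 blocks as with 3, and F(4, 4) = 4656 compensates. *)
Require Import Defs.
From mathcomp Require Import all_boot all_order all_algebra.
From mathcomp Require Import ring zify.

Set Implicit Arguments.
Unset Strict Implicit.
Unset Printing Implicit Defensive.

(** * Uniqueness of coefficients in the falling factorial basis *)

(** The system is triangular: at [q = k] the terms of index above [k] vanish and the [k]-th one
    carries the nonzero factor [k!], so strong induction on [k] applies. *)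
Lemma ffact_coef_inj N (s t : nat -> nat) :
  (forall q, \sum_(k < N) s k * q ^_ k = \sum_(k < N) t k * q ^_ k) ->
  forall k, k < N -> s k = t k.
Proof.
move=> eq_st; elim/ltn_ind => k IHk lt_kN.
have kfact (u : nat -> nat) : \sum_(i < N) u i * k ^_ i =
    \sum_(i < k) u i * k ^_ i + u k * k`!.
  rewrite -[N in LHS](subnKC lt_kN) big_split_ord /= big_ord_recr /= ffactnn.
  rewrite [X in _ + X]big1 ?addn0 // => i _.
  by rewrite ffact_small ?muln0 // addSn ltnS leq_addr.
have := eq_st k; rewrite !kfact (eq_bigr (fun i : 'I_k => t i * k ^_ i)).
  by move/addnI/eqP; rewrite eqn_pmul2r ?fact_gt0 // => /eqP.
by move=> i _; rewrite IHk // (ltn_trans _ lt_kN).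
Qed.

(** Makes the functional [q ^_ k |-> phi k] well defined without polynomials: terms with equal
    exponent are collected, then uniqueness applies. *)
Lemma ffact_umbral (I J : finType) (c : I -> nat) (m : I -> nat)
    (d : J -> nat) (n : J -> nat) :
  (forall q, \sum_i c i * q ^_ m i = \sum_j d j * q ^_ n j) ->
  forall phi : nat -> nat, \sum_i c i * phi (m i) = \sum_j d j * phi (n j).
Proof.
move=> eq_cd phi.
pose N := (maxn (\max_i m i) (\max_j n j)).+1.
have mN i : m i < N by rewrite ltnS leq_max leq_bigmax.
have nN j : n j < N by rewrite ltnS leq_max leq_bigmax orbT.
have collect (K : finType) (e : K -> nat) (h : K -> nat) (psi : nat -> nat) :
    (forall i, h i < N) ->
    \sum_i e i * psi (h i) = \sum_(k < N) (\sum_(i | h i == k) e i) * psi k.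
  move=> hN; rewrite (partition_big (fun i => Ordinal (hN i)) predT) //=.
  apply: eq_bigr => k _; rewrite big_distrl /=.
  by apply: eq_big => [i | i /eqP <-].
rewrite (collect _ c m) // (collect _ d n) //; apply: eq_bigr => k _; congr (_ * _).
apply: (ffact_coef_inj (N := N) (s := fun k => \sum_(i | m i == k) c i)
  (t := fun k => \sum_(i | n i == k) d i)) => // q.
by rewrite -(collect _ c m (fun k => q ^_ k)) // -(collect _ d n (fun k => q ^_ k)).
Qed.

(** * Proper colorings with [q] colors, sorted by their kernels *)

Definition proper_coloring (G : sgraph) q (f : {ffun G -> 'I_q}) :=
  [forall x, forall y, adj x y ==> (f x != f y)].

Definition num_proper (G : sgraph) q := #|[set f : {ffun G -> 'I_q} | proper_coloring f]|.

Lemma proper_coloringP (G : sgraph) q (f : {ffun G -> 'I_q}) :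
  reflect (forall x y, adj x y -> f x != f y) (proper_coloring f).
Proof.
apply: (iffP forallP) => [fP x y | fP x].
  by move/forallP: (fP x) => /(_ y) /implyP.
by apply/forallP => y; apply/implyP/fP.
Qed.

Section Kernel.
Variables (T : finType) (q : nat).

Lemma mem_preim_partition (f : T -> 'I_q) x y :
  (y \in pblock (preim_partition f [set: T]) x) = (f x == f y).
Proof.
rewrite pblock_equivalence_partition ?inE //.
by split=> [|/eqP ->].
Qed.

Lemma preim_partition_eq (P : {set {set T}}) (f : T -> 'I_q) :
  partition P [set: T] ->
  reflect (forall x y, (f x == f y) = (pblock P x == pblock P y))
          (preim_partition f [set: T] == P).
Proof.
move=> partP; have /and3P[/eqP covP trivP _] := partP.
have inP x : x \in cover P by rewrite covP inE.
apply: (iffP eqP) => [eqP x y | fP].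
  by rewrite -mem_preim_partition eqP eq_pblock.
rewrite -[RHS](preim_partition_pblock partP); apply: eq_in_imset => x _.
by apply/setP => y; rewrite !inE fP.
Qed.

(** Maps with kernel [P] are the injections from the set of blocks of [P] into ['I_q]. *)
Lemma card_preim_partition (P : {set {set T}}) : partition P [set: T] ->
  #|[set f : {ffun T -> 'I_q} | preim_partition f [set: T] == P]| = q ^_ #|P|.
Proof.
move=> partP; have /and3P[/eqP covP trivP P0] := partP.
have inP x : pblock P x \in P by rewrite pblock_mem // covP inE.
pose B x : {A | A \in P} := Sub (pblock P x) (inP x).
have Bsurj A : {x | B x = A}.
  have [x xA] : {x | x \in val A}.
    by apply/sigW/set0Pn/(partition_neq0 partP)/valP.
  by exists x; apply: val_inj; rewrite /= (def_pblock trivP _ xA) ?(valP A).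
pose F (g : {ffun {A | A \in P} -> 'I_q}) : {ffun T -> 'I_q} := [ffun x => g (B x)].
have Finj : injective F.
  move=> g h /ffunP eqF; apply/ffunP => A; have [x <-] := Bsurj A.
  by have := eqF x; rewrite !ffunE.
have -> : [set f : {ffun T -> 'I_q} | preim_partition f [set: T] == P]
    = F @: [set g : {ffun {A | A \in P} -> 'I_q} | injectiveb g].
  apply/setP => f; rewrite inE; apply/preim_partition_eq/imsetP => // [fP | [g]].
    exists [ffun A => f (sval (Bsurj A))].
      rewrite inE; apply/injectiveP => A A'; rewrite !ffunE => /eqP.
      case: (Bsurj A) (Bsurj A') => [x BxA] [y ByA'] /=.
      by rewrite fP -BxA -ByA' => /eqP eqB; apply: val_inj.
    apply/ffunP => x; rewrite !ffunE; case: (Bsurj _) => y /= By.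
    by move/(congr1 val): By => /= By; apply/eqP; rewrite fP By.
  rewrite inE => /injectiveP ginj -> x y.
  by rewrite !ffunE (inj_eq ginj).
rewrite card_imset // card_inj_ffuns card_ord.
by rewrite card_sig.
Qed.

End Kernel.

Lemma num_properE (G : sgraph) q :
  num_proper G q = \sum_(P | coloring (G := G) P) q ^_ #|P|.
Proof.
rewrite /num_proper -sum1dep_card.
rewrite (partition_big (fun f : {ffun G -> 'I_q} => preim_partition f [set: G])
  (fun P => coloring (G := G) P)) /=.
  apply: eq_bigr => P /andP[partP /forallP stabP].
  rewrite -(card_preim_partition q partP) sum1dep_card; apply: eq_card => f.
  rewrite !inE andb_idl // => /preim_partition_eq fP; apply/proper_coloringP => x y xy.
  have /and3P[/eqP covP trivP _] := partP.
  have inP z : z \in cover P by rewrite covP inE.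
  rewrite fP // eq_pblock //; apply/negP => yx.
  have /implyP/(_ (pblock_mem (inP x)))/forallP/(_ x) := stabP (pblock P x).
  rewrite mem_pblock inP => /forallP/(_ y); rewrite yx /=.
  by rewrite xy.
move=> f /proper_coloringP fP; rewrite /coloring preim_partitionP.
apply/forallP => A; apply/implyP => /imsetP[z _ ->].
apply/forallP => x; apply/implyP; rewrite !inE /= => /eqP zx.
apply/forallP => y; apply/implyP; rewrite !inE /= => /eqP zy.
by apply/negP => /fP; rewrite -zx -zy eqxx.
Qed.

Lemma coloring_card (G : sgraph) (P : {set {set G}}) :
  0 < #|G| -> coloring P -> 0 < #|P| <= #|G|.
Proof.
move=> G0 /andP[partP _]; apply/andP; split.
  apply: contraLR G0; rewrite -!eqn0Ngt cards_eq0 => /eqP P0.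
  by rewrite -cardsT (card_partition partP) P0 big_set0.
rewrite -cardsT (card_partition partP) -sum1_card; apply: leq_sum => A PA.
by rewrite card_gt0 (partition_neq0 partP).
Qed.

(** For the empty graph the empty partition is a coloring with 0 blocks, which a sum starting at 1
    misses; hence the hypothesis. *)
Lemma sum_num_colorings (G : sgraph) (phi : nat -> nat) : 0 < #|G| ->
  \sum_(1 <= k < #|G|.+1) phi k * num_colorings G k
    = \sum_(P | coloring (G := G) P) phi #|P|.
Proof.
move=> G0; have cardP P := coloring_card (P := P) G0.
transitivity (\sum_(1 <= k < #|G|.+1)
    \sum_(P : {set {set G}} | coloring P && (#|P| == k)) phi #|P|).
  apply: eq_bigr => k _; rewrite /num_colorings -sum1dep_card big_distrr /=.
  by apply: eq_bigr => P /andP[_ /eqP <-]; rewrite muln1.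
rewrite (exchange_big_dep (fun P => coloring (G := G) P)) /=;
  last by move=> k P _ /andP[].
apply: eq_bigr => P colP; rewrite (eq_bigl (fun k => k == #|P|)); last first.
  by move=> k; rewrite colP eq_sym.
by rewrite big_nat1_eq ltnS cardP.
Qed.

Section Umbral.
Variables (G : sgraph) (I : finType) (c m : I -> nat).
Hypothesis G_gt0 : 0 < #|G|.
Hypothesis G_proper : forall q, num_proper G q = \sum_i c i * q ^_ m i.

Let colorings_umbral (phi : nat -> nat) :
  \sum_(1 <= k < #|G|.+1) phi k * num_colorings G k = \sum_i c i * phi (m i).
Proof.
rewrite sum_num_colorings //.
(* Weights 0 and 1 give a sum over a whole finite type, as [ffact_umbral] expects. *)
transitivity (\sum_(P : {set {set G}}) coloring P * phi #|P|).
  by rewrite big_mkcond; apply: eq_bigr => P _; case: coloring; rewrite ?mul1n.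
apply: ffact_umbral => q; rewrite -G_proper num_properE [RHS]big_mkcond.
by apply: eq_bigr => P _; case: coloring; rewrite ?mul1n.
Qed.

Lemma calB_umbral : calB G = \sum_i c i.
Proof.
rewrite /calB -(eq_bigr _ (fun k _ => mul1n _)) (colorings_umbral (fun=> 1)).
by apply: eq_bigr => i _; rewrite muln1.
Qed.

Lemma calT_umbral : calT G = \sum_i c i * m i.
Proof. exact: (colorings_umbral id). Qed.

End Umbral.

(** * Chromatic polynomials of unions, copies, complete graphs and [C_4] *)

Lemma num_proper_union (G H : sgraph) q :
  num_proper (disjoint_union G H) q = num_proper G q * num_proper H q.
Proof.
rewrite /num_proper -cardsX.
pose F (fg : {ffun G -> 'I_q} * {ffun H -> 'I_q}) : {ffun disjoint_union G H -> 'I_q} :=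
  [ffun u => match u with inl x => fg.1 x | inr y => fg.2 y end].
have Finj : injective F.
  move=> [f g] [f' g'] /ffunP eqF; congr (_, _); apply/ffunP => x.
    by have := eqF (inl x); rewrite !ffunE.
  by have := eqF (inr x); rewrite !ffunE.
rewrite -(card_imset _ Finj); apply: eq_card => h; rewrite inE.
apply/proper_coloringP/imsetP => [hP | [[f g]] /setXP[]].
  exists ([ffun x => h (inl x)], [ffun x => h (inr x)]).
    by rewrite !inE /=; apply/andP; split; apply/proper_coloringP => x y xy;
       rewrite !ffunE; apply: hP.
  by apply/ffunP => -[x|x]; rewrite !ffunE.
rewrite !inE => /proper_coloringP fP /proper_coloringP gP -> [x|x] [y|y] //= xy;
  rewrite !ffunE /=.
- exact: fP.
- exact: gP.
Qed.

Lemma num_proper_copies p (H : sgraph) q :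
  num_proper (copies p H) q = num_proper H q ^ p.
Proof.
rewrite -[p in RHS]card_ord -card_ffun_on /num_proper.
pose F (g : {ffun 'I_p -> {ffun H -> 'I_q}}) : {ffun copies p H -> 'I_q} :=
  [ffun u => g u.1 u.2].
have Finj : injective F.
  move=> f g /ffunP eqF; apply/ffunP => i; apply/ffunP => x.
  by have := eqF (i, x); rewrite !ffunE.
rewrite -(card_imset _ Finj); apply: eq_card => h; rewrite inE.
apply/proper_coloringP/imsetP => [hP | [g /ffun_onP gP ->]].
  exists [ffun i => [ffun x => h (i, x)]].
    apply/ffun_onP => i; rewrite ffunE inE; apply/proper_coloringP => x y xy.
    by rewrite !ffunE; apply: hP; rewrite /= /copies_adj eqxx.
  by apply/ffunP => -[i x]; rewrite !ffunE.
move=> [i x] [j y] /andP[/= /eqP <- xy]; rewrite !ffunE /=.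
by have := gP i; rewrite inE => /proper_coloringP; apply.
Qed.

Lemma num_proper_complete m q : num_proper (complete_graph m) q = q ^_ m.
Proof.
rewrite /num_proper -[m in RHS]card_ord -[q in RHS]card_ord -card_inj_ffuns.
apply: eq_card => f; rewrite !inE.
apply/proper_coloringP/injectiveP => [fP x y | finj x y].
  by move/eqP; apply: contraTeq => /fP.
by rewrite (inj_eq finj).
Qed.

(** Free of truncated subtraction, this form lets [ring] decide identities between falling
    factorials. *)
Lemma natr_ffact (R : pzRingType) q m :
  ((q ^_ m)%:R = \prod_(i < m) (q%:R - i%:R) :> R)%R.
Proof.
elim: m => [|m IHm]; first by rewrite big_ord0.
rewrite ffactnSr big_ord_recr /= -IHm GRing.natrM.
have [le_mq | lt_qm] := leqP m q; first by rewrite GRing.natrB.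
by rewrite ffact_small // !GRing.mul0r.
Qed.

(** Once the opposite vertices 0 and 2 are colored, vertices 1 and 3 choose independently among the
    remaining [q - 1] or [q - 2] colors, according to whether the first two colors agree. *)
Lemma num_proper_cycle4 q :
  num_proper (cycle_graph 4) q = q ^_ 4 + 2 * q ^_ 3 + q ^_ 2.
Proof.
pose A (u : 'I_q * 'I_q) := [set x | (x != u.1) && (x != u.2)].
have cardA u : #|A u| = q - (u.1 != u.2).+1.
  have -> : A u = ~: [set u.1; u.2] by apply/setP => x; rewrite !inE negb_or.
  by rewrite cardsCs setCK card_ord cards2.
pose F (t : ('I_q * 'I_q) * ('I_q * 'I_q)) : {ffun cycle_graph 4 -> 'I_q} :=
  [ffun i : 'I_4 => nth t.1.1 [:: t.1.1; t.2.1; t.1.2; t.2.2] i].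
have Finj : injective F.
  move=> [[a b] [c d]] [[a' b'] [c' d']] /ffunP eqF.
  have := eqF (inord 0); have := eqF (inord 1).
  have := eqF (inord 2); have := eqF (inord 3).
  by rewrite !ffunE !inordK //= => -> -> -> ->.
transitivity (#|[set t : ('I_q * 'I_q) * ('I_q * 'I_q) | t.2 \in setX (A t.1) (A t.1)]|).
  rewrite /num_proper -(card_imset _ Finj); apply: eq_card => h; rewrite inE.
  apply/proper_coloringP/imsetP => [hP | [[[a c] [b d]]]].
    exists ((h (inord 0), h (inord 2)), (h (inord 1), h (inord 3))).
      by rewrite !inE /= -!andbA; apply/and4P; split; apply: hP;
         rewrite /= /cycle_adj -!val_eqE /= !inordK.
    apply/ffunP => i; rewrite ffunE /=.
    by case: i => [[|[|[|[|//]]]] lti] /=; congr (h _); apply: val_inj; rewrite /= inordK.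
  rewrite !inE /= -!andbA => /and4P[ba bc da dc] -> [i lti] [j ltj].
  rewrite /= /cycle_adj -!val_eqE /= !ffunE /=.
  by move: i j lti ltj => [|[|[|[|//]]]] [|[|[|[|//]]]] //= _ _ _; rewrite // eq_sym.
rewrite -sum1dep_card.
rewrite -(pair_big_dep predT (fun u v => v \in setX (A u) (A u)) (fun _ _ => 1)) /=.
under eq_bigr => u _ do rewrite sum1_card cardsX cardA.
rewrite -(pair_bigA _ (fun a b => (q - (a != b).+1) * (q - (a != b).+1))) /=.
under eq_bigr => a _.
  rewrite (bigD1 a) //= eqxx (eq_bigr (fun=> (q - 2) * (q - 2))); last first.
    by move=> b; rewrite eq_sym => ->.
  rewrite sum_nat_const cardC1 card_ord.
  over.
rewrite sum_nat_const card_ord; case: q {A cardA F Finj} => [|[|[|q]]] //.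
rewrite !ffactnS !ffactn0 subn1 subn2 /=; ring.
Qed.

(** * Multiplication in the falling factorial basis *)

Lemma ffactnD q k m : q ^_ (k + m) = q ^_ k * (q - k) ^_ m.
Proof.
elim: m => [|m IHm]; first by rewrite addn0 ffactn0 muln1.
by rewrite addnS !ffactnSr IHm -mulnA subnDA.
Qed.

(* [natr_ffact] comes first because [natrM] would match [q ^_ m.+1] up to
   conversion and split off a truncated predecessor. *)
Ltac ffact_ring :=
  apply/eqP; rewrite -(@Num.Theory.eqr_nat int); apply/eqP;
  rewrite ?(natr_ffact, GRing.natrD, GRing.natrM, GRing.natrX,
            big_ord_recr, big_ord0) /=; ring.

(** With [q = k + d], the Vandermonde expansion of each [(k + d) ^_ i] in the [d ^_ j] gives these
    coefficients; [d ^_ j] then combines with [q ^_ k] into [q ^_ (k + j)]. *)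
Definition cycle4_coef k : nat -> nat :=
  nth 0 [:: k ^_ 4 + 2 * k ^_ 3 + k ^_ 2; 4 * k ^_ 3 + 6 * k ^_ 2 + 2 * k;
            6 * k ^_ 2 + 6 * k + 1; 4 * k + 2; 1].

Definition triangle_point_coef k : nat -> nat :=
  nth 0 [:: k ^_ 4 + 3 * k ^_ 3; 4 * k ^_ 3 + 9 * k ^_ 2;
            6 * k ^_ 2 + 9 * k; 4 * k + 3; 1].

Lemma mul_ffact_cycle4 q k :
  q ^_ k * (q ^_ 4 + 2 * q ^_ 3 + q ^_ 2)
    = \sum_(j < 5) cycle4_coef k j * q ^_ (k + j).
Proof.
under eq_bigr => j _ do rewrite ffactnD mulnCA.
rewrite -big_distrr /=.
have [lt_qk | le_kq] := ltnP q k; first by rewrite ffact_small.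
congr (_ * _); rewrite !big_ord_recr big_ord0 /= /cycle4_coef /=.
rewrite -[in LHS](subnKC le_kq); move: (q - k) => d; ffact_ring.
Qed.

Lemma mul_ffact_triangle_point q k :
  q ^_ k * (q ^_ 3 * q) = \sum_(j < 5) triangle_point_coef k j * q ^_ (k + j).
Proof.
under eq_bigr => j _ do rewrite ffactnD mulnCA.
rewrite -big_distrr /=.
have [lt_qk | le_kq] := ltnP q k; first by rewrite ffact_small.
congr (_ * _); rewrite !big_ord_recr big_ord0 /= /triangle_point_coef /=.
rewrite -[in LHS](subnKC le_kq); move: (q - k) => d; ffact_ring.
Qed.

(* [cycle4_B k] and [cycle4_T k] are the images of [q ^_ k] times the chromatic
   polynomial of C_4 under [q ^_ i |-> 1] and [q ^_ i |-> i]; [triangle_point_*]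
   is the same for K_3 u K_1. *)
Definition cycle4_B k := k ^ 4 + 6 * k ^ 2 + 5 * k + 4.
Definition cycle4_T k := k ^ 5 + 10 * k ^ 3 + 11 * k ^ 2 + 20 * k + 12.
Definition triangle_point_B k := k ^ 4 + k ^ 3 + 5 * k ^ 2 + 6 * k + 4.
Definition triangle_point_T k :=
  k ^ 5 + k ^ 4 + 9 * k ^ 3 + 15 * k ^ 2 + 21 * k + 13.

Lemma sum_cycle4_coef k : \sum_(j < 5) cycle4_coef k j = cycle4_B k.
Proof. rewrite !big_ord_recr big_ord0 /cycle4_coef /cycle4_B /=; ffact_ring. Qed.

Lemma sum_cycle4_coefM k : \sum_(j < 5) cycle4_coef k j * (k + j) = cycle4_T k.
Proof. rewrite !big_ord_recr big_ord0 /cycle4_coef /cycle4_T /=; ffact_ring. Qed.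

Lemma sum_triangle_point_coef k :
  \sum_(j < 5) triangle_point_coef k j = triangle_point_B k.
Proof.
rewrite !big_ord_recr big_ord0 /triangle_point_coef /triangle_point_B /=; ffact_ring.
Qed.

Lemma sum_triangle_point_coefM k :
  \sum_(j < 5) triangle_point_coef k j * (k + j) = triangle_point_T k.
Proof.
rewrite !big_ord_recr big_ord0 /triangle_point_coef /triangle_point_T /=; ffact_ring.
Qed.

(* The deficit 224 at [k = l = 3] is exact; for [3 < k <= l] the difference is
   a polynomial with nonnegative coefficients in [k - 4] and [l - k] (its value
   at [k = l = 4] is 4656, of which only 225 is kept), and for [3 = k < l] one
   in [l - 4]. *)
Lemma cycle4_triangle_point_pair k l : 3 <= k -> 3 <= l ->
  triangle_point_T k * cycle4_B l + triangle_point_T l * cycle4_B k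
    + 225 * ((k == 4) * (l == 4))
  <= cycle4_T k * triangle_point_B l + cycle4_T l * triangle_point_B k
    + 224 * ((k == 3) * (l == 3)).
Proof.
wlog le_kl : k l / k <= l => [IH k3 l3 | k3 l3].
  have [/IH-> // | /ltnW lk] := leqP k l; have := IH l k lk l3 k3.
  by rewrite [(l == 4) * _]mulnC [(l == 3) * _]mulnC [_ + _ * cycle4_B l]addnC
             [_ + _ * triangle_point_B l]addnC.
have [-> | kn3] := eqVneq k 3.
  have [-> | ln3] := eqVneq l 3.
    rewrite /triangle_point_T /triangle_point_B /cycle4_T /cycle4_B; lia.
  have [d ->] : exists d, l = d + 4 by exists (l - 4); lia.
  rewrite !muln0 !addn0 /triangle_point_T /triangle_point_B /cycle4_T /cycle4_B.
  set rhs := leqRHS; set lhs := leqLHS.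
  suff -> : rhs = lhs + (21 * d ^ 5 + 172 * d ^ 4 + 440 * d ^ 3 + 575 * d ^ 2
     + 1112 * d + 602) by rewrite leq_addr.
  by rewrite /rhs /lhs; ring.
have [x kE] : exists x, k = x + 4 by exists (k - 4); lia.
have [d ->] : exists d, l = x + d + 4 by exists (l - k); lia.
rewrite kE (_ : (_ == 3) = false) ?mul0n ?muln0 ?addn0; last lia.
apply: (@leq_trans (triangle_point_T (x + 4) * cycle4_B (x + d + 4) +
  triangle_point_T (x + d + 4) * cycle4_B (x + 4) + 225)).
  by rewrite leq_add2l -[leqRHS]muln1 leq_pmul2l // mulnb leq_b1.
rewrite /triangle_point_T /triangle_point_B /cycle4_T /cycle4_B.
set rhs := leqRHS; set lhs := leqLHS.
suff -> : rhs = lhs + (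
     x ^ 6 * d ^ 2 + 2 * x ^ 6 + 3 * x ^ 5 * d ^ 3 + 22 * x ^ 5 * d ^ 2 +
     6 * x ^ 5 * d + 50 * x ^ 5 + 3 * x ^ 4 * d ^ 4 +
     55 * x ^ 4 * d ^ 3 + 200 * x ^ 4 * d ^ 2 + 125 * x ^ 4 * d +
     510 * x ^ 4 + x ^ 3 * d ^ 5 + 44 * x ^ 3 * d ^ 4 +
     390 * x ^ 3 * d ^ 3 + 952 * x ^ 3 * d ^ 2 + 1020 * x ^ 3 * d +
     2682 * x ^ 3 + 11 * x ^ 2 * d ^ 5 + 235 * x ^ 2 * d ^ 4 +
     1303 * x ^ 2 * d ^ 3 + 2469 * x ^ 2 * d ^ 2 + 4023 * x ^ 2 * d +
     7506 * x ^ 2 + 41 * x * d ^ 5 + 530 * x * d ^ 4 + 1959 * x * d ^ 3 +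
     3253 * x * d ^ 2 + 7506 * x * d + 10166 * x + 52 * d ^ 5 +
     403 * d ^ 4 + 956 * d ^ 3 + 1634 * d ^ 2 + 5083 * d + 4431) by rewrite leq_addr.
by rewrite /rhs /lhs; ring.
Qed.

Lemma double_sum_sym (I : finType) (f g : I -> nat) :
  \sum_i \sum_j (f i * g j + f j * g i) = 2 * ((\sum_i f i) * (\sum_i g i)).
Proof.
rewrite mul2n -addnn {2}mulnC !big_distrlr /= -big_split /=.
apply: eq_bigr => i _; rewrite -big_split /=.
by apply: eq_bigr => j _; rewrite [f j * _]mulnC.
Qed.

(** The pairwise inequality is weighted by [c i * c j] and summed over all pairs; the indicator
    products add up to the squares. *)
Lemma cycle4_triangle_point_sum (I : finType) (c m : I -> nat) :
  (forall i, 0 < c i -> 3 <= m i) ->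
  2 * ((\sum_i c i * triangle_point_T (m i)) * (\sum_i c i * cycle4_B (m i)))
    + 225 * (\sum_i c i * (m i == 4)) ^ 2
  <= 2 * ((\sum_i c i * cycle4_T (m i)) * (\sum_i c i * triangle_point_B (m i)))
    + 224 * (\sum_i c i * (m i == 3)) ^ 2.
Proof.
move=> m3; rewrite -!double_sum_sym -!mulnn !big_distrlr /= !big_distrr /= -!big_split /=.
apply: leq_sum => i _; rewrite !big_distrr /= -!big_split /=.
apply: leq_sum => j _.
have [-> | ci0] := posnP (c i); first by rewrite !mul0n !muln0.
have [-> | cj0] := posnP (c j); first by rewrite !mul0n !muln0.
have := leq_mul (leqnn (c i * c j))
  (cycle4_triangle_point_pair (m3 _ ci0) (m3 _ cj0)).
move: (cycle4_B _) (cycle4_B _) (cycle4_T _) (cycle4_T _) (triangle_point_B _)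
  (triangle_point_B _) (triangle_point_T _) (triangle_point_T _).
move: (nat_of_bool _) (nat_of_bool _) (nat_of_bool _) (nat_of_bool _) (c i) (c j).
by do 14!move=> ?; congr (_ <= _); ring.
Qed.

(** * [calB] and [calT] when the chromatic polynomial is a product *)

Section Multiply.
Variables (G : sgraph) (I : finType) (c m : I -> nat).
Variables (f : nat -> nat) (d : nat -> nat -> nat) (N : nat).
Hypothesis G_gt0 : 0 < #|G|.
Hypothesis G_proper : forall q, num_proper G q = (\sum_i c i * q ^_ m i) * f q.
Hypothesis f_ffact :
  forall q k, q ^_ k * f q = \sum_(j < N) d k j * q ^_ (k + j).

Let num_proper_pair q : num_proper G q =
  \sum_(ij : I * 'I_N) (c ij.1 * d (m ij.1) ij.2) * q ^_ (m ij.1 + ij.2).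
Proof.
rewrite G_proper big_distrl /=.
rewrite -(pair_bigA _ (fun i (j : 'I_N) => c i * d (m i) j * q ^_ (m i + j))).
apply: eq_bigr => i _; rewrite -mulnA f_ffact big_distrr /=.
by apply: eq_bigr => j _; rewrite mulnA.
Qed.

Lemma calB_mul : calB G = \sum_i c i * (\sum_(j < N) d (m i) j).
Proof.
rewrite (calB_umbral G_gt0 num_proper_pair).
rewrite -(pair_bigA _ (fun i (j : 'I_N) => c i * d (m i) j)).
by apply: eq_bigr => i _; rewrite big_distrr.
Qed.

Lemma calT_mul : calT G = \sum_i c i * (\sum_(j < N) d (m i) j * (m i + j)).
Proof.
rewrite (calT_umbral G_gt0 num_proper_pair).
rewrite -(pair_bigA _ (fun i (j : 'I_N) => c i * d (m i) j * (m i + j))).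
by apply: eq_bigr => i _; rewrite big_distrr; apply: eq_bigr => j _ /=; rewrite mulnA.
Qed.

End Multiply.

(** * The four sums, from any expansion of [(q ^_ 3) ^ p] *)

Section TrianglesExpansion.
Variables (p : nat) (I : finType) (c m : I -> nat).
Hypothesis triangles : forall q, (q ^_ 3) ^ p = \sum_i c i * q ^_ m i.

Let X := disjoint_union (copies p (complete_graph 3)) (cycle_graph 4).
Let Y := disjoint_union (copies p.+1 (complete_graph 3)) (complete_graph 1).

Let X_gt0 : 0 < #|X|.
(* The vertex is taken in [C_4] because the copies of [K_3] have none when [p = 0]. *)
Proof. by apply/card_gt0P; exists (inr ord0). Qed.

Let Y_gt0 : 0 < #|Y|.
Proof. by apply/card_gt0P; exists (inr ord0). Qed.

Let X_proper q : num_proper X q =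
  (\sum_i c i * q ^_ m i) * (q ^_ 4 + 2 * q ^_ 3 + q ^_ 2).
Proof.
by rewrite num_proper_union num_proper_copies num_proper_complete
           num_proper_cycle4 triangles.
Qed.

Let Y_proper q : num_proper Y q = (\sum_i c i * q ^_ m i) * (q ^_ 3 * q).
Proof.
rewrite num_proper_union num_proper_copies !num_proper_complete ffactn1.
by rewrite expnSr triangles mulnA.
Qed.

Lemma calB_triangles_cycle4 : calB X = \sum_i c i * cycle4_B (m i).
Proof.
rewrite (calB_mul X_gt0 X_proper mul_ffact_cycle4).
by apply: eq_bigr => i _; rewrite sum_cycle4_coef.
Qed.

Lemma calT_triangles_cycle4 : calT X = \sum_i c i * cycle4_T (m i).
Proof.
rewrite (calT_mul X_gt0 X_proper mul_ffact_cycle4).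
by apply: eq_bigr => i _; rewrite sum_cycle4_coefM.
Qed.

Lemma calB_triangles_point : calB Y = \sum_i c i * triangle_point_B (m i).
Proof.
rewrite (calB_mul Y_gt0 Y_proper mul_ffact_triangle_point).
by apply: eq_bigr => i _; rewrite sum_triangle_point_coef.
Qed.

Lemma calT_triangles_point : calT Y = \sum_i c i * triangle_point_T (m i).
Proof.
rewrite (calT_mul Y_gt0 Y_proper mul_ffact_triangle_point).
by apply: eq_bigr => i _; rewrite sum_triangle_point_coefM.
Qed.

End TrianglesExpansion.

(** * Comparison of the averages *)

Lemma ltr_calA (G H : sgraph) : 0 < calB G -> 0 < calB H ->
  (calA G < calA H)%R = (calT G * calB H < calT H * calB G).
Proof.
move=> G0 H0; rewrite /calA Num.Theory.ltr_pdivrMr ?Num.Theory.ltr0n // GRing.mulrAC.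
by rewrite Num.Theory.ltr_pdivlMr ?Num.Theory.ltr0n // -!GRing.natrM Num.Theory.ltr_nat.
Qed.

(** Serves [p = 0] with [k = 0] and [p = 1] with [k = 3], where the expansion has a single term and
    the comparison is numerical. *)
Lemma triangles_cycle4_lt p k :
  (forall q, (q ^_ 3) ^ p = q ^_ k) ->
  cycle4_T k * triangle_point_B k < triangle_point_T k * cycle4_B k ->
  (calA (disjoint_union (copies p (complete_graph 3)) (cycle_graph 4))
   < calA (disjoint_union (copies p.+1 (complete_graph 3)) (complete_graph 1)))%R.
Proof.
move=> pk ltk.
have exp q : (q ^_ 3) ^ p = \sum_(i : 'I_1) 1 * q ^_ k by rewrite big_ord1 mul1n.
have BX := calB_triangles_cycle4 exp; have BY := calB_triangles_point exp.
have TX := calT_triangles_cycle4 exp; have TY := calT_triangles_point exp.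
rewrite !big_ord1 !mul1n in BX BY TX TY.
rewrite ltr_calA ?BX ?BY ?TX ?TY //.
  by rewrite /cycle4_B addnS.
by rewrite /triangle_point_B addnS.
Qed.

Lemma triangles_cycle4_gt p : 1 < p ->
  (calA (disjoint_union (copies p.+1 (complete_graph 3)) (complete_graph 1))
   < calA (disjoint_union (copies p (complete_graph 3)) (cycle_graph 4)))%R.
Proof.
move=> p1; pose G := copies p (complete_graph 3).
pose c (P : {set {set G}}) : nat := coloring P.
have exp q : (q ^_ 3) ^ p = \sum_P c P * q ^_ #|P|.
  rewrite -num_proper_complete -num_proper_copies num_properE big_mkcond /=.
  by apply: eq_bigr => P _; rewrite /c; case: coloring; rewrite ?mul1n.
have c3 P : 0 < c P -> 3 <= #|P|.
  (* At [q = 2] the left side is 0, so every term is 0; a positive coefficient forces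
     [2 ^_ #|P| = 0]. *)
  have := exp 2; rewrite (@ffact_small 2 3) // exp0n; last by rewrite ltnW.
  move=> /esym/eqP; rewrite sum_nat_eq0.
  move=> /forallP/(_ P); rewrite /= muln_eq0 => /orP[/eqP -> // | ].
  by rewrite -leqn0 leqNgt ffact_gt0 -ltnNge.
pose s k := \sum_P c P * (#|P| == k).
(* At [q = 3] only the colorings with 3 blocks survive. At [q = 4] those with 3 or 4 blocks do, both
   with factor [4 ^_ 3 = 4 ^_ 4 = 24]. *)
have s3 : 6 ^ p = 6 * s 3.
  rewrite (exp 3) /s big_distrr /=; apply: eq_bigr => P _.
  have [-> | /c3 le3P] := posnP (c P); first by rewrite muln0.
  rewrite mulnCA; congr (_ * _); have [-> // | n3] := eqVneq.
  by rewrite ffact_small // ltn_neqAle eq_sym n3.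
have s4 : 24 ^ p = 24 * s 3 + 24 * s 4.
  rewrite (exp 4) /s !big_distrr -big_split /=; apply: eq_bigr => P _.
  have [-> | /c3 le3P] := posnP (c P); first by rewrite !muln0.
  rewrite !(mulnCA 24) -mulnDr; congr (_ * _).
  have [-> // | n3] := eqVneq #|P| 3; have [-> // | n4] := eqVneq #|P| 4.
  by rewrite ffact_small // ltn_neqAle eq_sym n4 ltn_neqAle eq_sym n3.
(* For [p = r + 2] this reads [s 3 = 6 * 6 ^ r] and [s 3 + s 4 = 24 * 24 ^ r], the latter being at
   least [2 * s 3]. *)
have s34 : 0 < s 3 <= s 4.
  have [r pE] : exists r, p = r.+2 by exists (p - 2); lia.
  rewrite pE !expnS in s3 s4.
  have : 6 ^ r <= 24 ^ r by case: (r) => // r'; rewrite leq_exp2r.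
  have : 0 < 6 ^ r by rewrite expn_gt0.
  lia.
have BX : 0 < calB (disjoint_union G (cycle_graph 4)).
  rewrite (calB_triangles_cycle4 exp); apply: leq_trans (_ : s 4 <= _); first lia.
  apply: leq_sum => P _; rewrite leq_mul2l; case: (_ == 4); rewrite ?orbT //.
  by rewrite /cycle4_B addnS orbT.
have BY : 0 < calB (disjoint_union (copies p.+1 (complete_graph 3)) (complete_graph 1)).
  rewrite (calB_triangles_point exp); apply: leq_trans (_ : s 4 <= _); first lia.
  apply: leq_sum => P _; rewrite leq_mul2l; case: (_ == 4); rewrite ?orbT //.
  by rewrite /triangle_point_B addnS orbT.
rewrite ltr_calA // (calB_triangles_cycle4 exp) (calB_triangles_point exp).
rewrite (calT_triangles_cycle4 exp) (calT_triangles_point exp).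
have := cycle4_triangle_point_sum c3; rewrite -!/(s _).
(* Keeping 225, one more than the deficit 224, is what makes the inequality strict. *)
have : 224 * s 3 ^ 2 < 225 * s 4 ^ 2 by case/andP: s34 => s0 s34; nia.
lia.
Qed.

Theorem theorem17 (p : nat) :
  (p = 0 \/ p = 1 ->
    (calA (disjoint_union (copies p (complete_graph 3)) (cycle_graph 4))
     < calA (disjoint_union (copies p.+1 (complete_graph 3))
                            (complete_graph 1)))%R) /\
  (2 <= p ->
    (calA (disjoint_union (copies p (complete_graph 3)) (cycle_graph 4))
     > calA (disjoint_union (copies p.+1 (complete_graph 3))
                            (complete_graph 1)))%R).
Proof.
split=> [[-> | ->] | /triangles_cycle4_gt //].
- by apply: (@triangles_cycle4_lt 0 0).
- by apply: (@triangles_cycle4_lt 1 3).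
Qed.
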